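(* Let $f:\mathbb{R}^n\to\mathbb{R}$ be smooth, $\psi:\mathbb{R}^n\to\mathbb{R}$, $\phi=f+\psi$, and let $\mathbf{x}_1,\mathbf{x}_2,\ldots$ be the iterates generated by SpaRSA (defined in the context) for minimizing $\phi$. Suppose that: (A1) the level set $\mathcal{L}=\{\mathbf{x}\in\mathbb{R}^n:\phi(\mathbf{x})\le\phi(\mathbf{x}_1)\}$ is contained in the interior of a compact, convex set $\mathcal{K}$, and $f$ is Lipschitz continuously differentiable on $\mathcal{K}$; (A2) $\psi$ is convex and $\psi(\mathbf{x})$ is finite for all $\mathbf{x}\in\mathbb{R}^n$. If, in addition, $f$ is convex and $\phi_k^R=\phi_k^{\max}$ for all $k$, then there exist constants $a$ and $b$ such that $$\phi(\mathbf{x}_k)-\phi^*\le\frac{a}{b+k}$$ for $k$ sufficiently large, where $\phi^*=\min_{\mathbf{x}\in\mathbb{R}^n}\phi(\mathbf{x})$.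
   Context: ''Smooth'' means continuously differentiable. $\|\cdot\|$ is the Euclidean norm, and $\nabla f(\mathbf{x})$ is the gradient of $f$ written as a row vector. ''$f$ is Lipschitz continuously differentiable on $\mathcal{K}$'' means that $\nabla f$ is Lipschitz continuous on $\mathcal{K}$. Under (A1) and (A2), the minimum $\phi^*$ of $\phi$ over $\mathbb{R}^n$ is attained. SpaRSA algorithm. Given $\eta>1$, $\sigma\in(0,1)$, $[\alpha_{\min},\alpha_{\max}]\subset(0,\infty)$ and a starting guess $\mathbf{x}_1\in\mathbb{R}^n$, set $k=1$. Step 1: Choose $\alpha_0\in[\alpha_{\min},\alpha_{\max}]$ (the choice may differ from iteration to iteration). Step 2: Set $\alpha=\eta^j\alpha_0$, where $j\ge0$ is the smallest integer such that $\phi(\mathbf{x}_{k+1})\le\phi_k^R-\sigma\alpha\|\mathbf{x}_{k+1}-\mathbf{x}_k\|^2$, where $\mathbf{x}_{k+1}=\arg\min\{\nabla f(\mathbf{x}_k)\mathbf{z}+\alpha\|\mathbf{z}-\mathbf{x}_k\|^2+\psi(\mathbf{z}):\mathbf{z}\in\mathbb{R}^n\}$. Step 3: If $\mathbf{x}_{k+1}=\mathbf{x}_k$, terminate. Step 4: Set $k=k+1$ and go to Step 1. Here $\phi_k^R$ is a real number called the reference value at iteration $k$. For a fixed integer $M\ge1$, the GLL reference value is $\phi_k^{\max}=\max\{\phi(\mathbf{x}_{k-j}):0\le j<\min(k,M)\}$. Statements about large $k$ refer to the case where the algorithm does not terminate in Step 3 and so produces an infinite sequence of iterates. *)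

(* Defs.v *)
From HB Require Import structures.
From mathcomp Require Import all_boot all_order all_algebra.
From mathcomp Require Import all_classical all_reals all_analysis.

Set Implicit Arguments.
Unset Strict Implicit.
Unset Printing Implicit Defensive.
Import Order.TTheory GRing.Theory Num.Theory.
Import numFieldNormedType.Exports.
Local Open Scope classical_set_scope.
Local Open Scope ring_scope.

Section Euclidean.
Context {R : realType} {n : nat}.

(* The library norm on 'rV[R]_n is the sup norm; its topology is the usual one,
   but the Euclidean norm has to be written out. *)
Definition dotp (u v : 'rV[R]_n) : R := \sum_(i < n) u 0 i * v 0 i.

Definition enorm (u : 'rV[R]_n) : R := Num.sqrt (dotp u u).

Definition grad (f : 'rV[R]_n -> R) (x : 'rV[R]_n) : 'rV[R]_n :=
  \row_(i < n) 'D_(delta_mx 0 i) f x.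

Definition continuously_differentiable (f : 'rV[R]_n -> R) : Prop :=
  (forall x, differentiable f x) /\ continuous (grad f).

Definition lipschitz_grad_on (K : set 'rV[R]_n) (f : 'rV[R]_n -> R) : Prop :=
  exists L : R, forall x y, K x -> K y ->
    enorm (grad f x - grad f y) <= L * enorm (x - y).

Definition level_set (phi : 'rV[R]_n -> R) (c : R) : set 'rV[R]_n :=
  [set x | phi x <= c].

Definition is_argmin (g : 'rV[R]_n -> R) (z : 'rV[R]_n) : Prop :=
  forall y, g z <= g y.

Definition is_minimum (g : 'rV[R]_n -> R) (m : R) : Prop :=
  exists2 z, is_argmin g z & g z = m.

End Euclidean.

Section SpaRSA.
Context {R : realType} {n : nat}.
Variables (f psi : 'rV[R]_n -> R) (eta sigma alphamin alphamax : R).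

Definition sparsa_model (x : 'rV[R]_n) (alpha : R) (z : 'rV[R]_n) : R :=
  dotp (grad f x) z + alpha * enorm (z - x) ^+ 2 + psi z.

(* z is the trial point at x for the parameter alpha, and it passes the
   acceptance test against the reference value r. *)
Definition sparsa_accept (r : R) (x : 'rV[R]_n) (alpha : R) (z : 'rV[R]_n) :
    Prop :=
  is_argmin (sparsa_model x alpha) z /\
  f z + psi z <= r - sigma * alpha * enorm (z - x) ^+ 2.

Definition sparsa_step (r : R) (x x' : 'rV[R]_n) : Prop :=
  exists2 alpha0 : R, alphamin <= alpha0 <= alphamax &
  exists2 j : nat, sparsa_accept r x (eta ^+ j * alpha0) x' &
    forall i : nat, (i < j)%N ->
      ~ exists z, sparsa_accept r x (eta ^+ i * alpha0) z.

(* A run that never stops in the termination test. Iterates and reference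
   values are numbered from 1; x 0 and phiR 0 play no role. *)
Definition sparsa_infinite_run (phiR : nat -> R) (x : nat -> 'rV[R]_n) : Prop :=
  forall k : nat, (1 <= k)%N ->
    sparsa_step (phiR k) (x k) (x k.+1) /\ x k.+1 <> x k.

End SpaRSA.

(* The default value phi (x k) of the iterated maximum is its term j = 0. *)
Definition gll_reference {R : realType} {n : nat} (phi : 'rV[R]_n -> R)
    (x : nat -> 'rV[R]_n) (M k : nat) : R :=
  \big[Num.max/phi (x k)]_(0 <= j < minn k M) phi (x (k - j)%N).

(* Main.v *)
Require Import Defs.
From HB Require Import structures.
From mathcomp Require Import all_boot all_order all_algebra.
From mathcomp Require Import all_classical all_reals all_analysis.
From mathcomp Require Import ring lra zify.

Set Implicit Arguments.
Unset Strict Implicit.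
Unset Printing Implicit Defensive.
Import Order.TTheory GRing.Theory Num.Theory.
Import numFieldNormedType.Exports.
Local Open Scope classical_set_scope.
Local Open Scope ring_scope.

(** The error [e_k = phi (x_k) - phi*] satisfies a quadratic recurrence over a
    window of [M] iterates, and such a recurrence forces the rate [1 / k].

    The minimum [phi*] exists because finite convex functions on row vectors are
    continuous ([convex_continuous]) and the level set of [phi (x 1)] sits inside
    the compact set [K].

    The parameters [alpha] accepted by the line search stay bounded
    ([sparsa_step_alpha]). When [alpha] is large compared with the Lipschitz
    constant, the minimizer of the model lies in [K] ([trial_point_in_compact])
    and passes the acceptance test ([large_alpha_accepted]). The backtracking
    therefore stops before [alpha] exceeds such a value by more than a factor
    [eta], provided that the model has a minimizer for each parameter tried
    ([sparsa_model_has_argmin]).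

    Minimality of the new iterate in the model, compared with the point
    [x_k + t (x* - x_k)] where [x*] minimizes [phi], gives for all [t] in [0, 1]
    [e_(k+1) <= (1 - t) e_k + t ^ 2 beta D + L |x_(k+1) - x_k| ^ 2]
    ([sparsa_accept_model_bound]), where [beta] bounds the parameters and [D]
    bounds squared distances in [K]. The acceptance test bounds the last term by
    a multiple of [E_k - e_(k+1)], where [E_k] is the largest error in the
    window. Optimizing over [t] yields [e_(k+1) <= E_k - g E_k ^ 2] for some
    [g > 0] ([quadratic_decrease]). Since [E_k] is one of the last [M] errors,
    induction gives [e_k <= (M / g) / k] ([windowed_quadratic_decrease_rate]). *)

(** * The Euclidean structure of row vectors *)

Section DotProduct.
Context {R : realType} {n : nat}.
Implicit Types u v w : 'rV[R]_n.

Lemma dotpC u v : dotp u v = dotp v u.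
Proof. by apply: eq_bigr => i _; rewrite mulrC. Qed.

Lemma dotpDr u v w : dotp u (v + w) = dotp u v + dotp u w.
Proof. by rewrite -big_split; apply: eq_bigr => i _; rewrite mxE mulrDr. Qed.

Lemma dotpZr a u v : dotp u (a *: v) = a * dotp u v.
Proof. by rewrite big_distrr; apply: eq_bigr => i _; rewrite mxE mulrCA. Qed.

Lemma dotpBr u v w : dotp u (v - w) = dotp u v - dotp u w.
Proof. by rewrite -scaleN1r dotpDr dotpZr mulN1r. Qed.

Lemma dotpDl u v w : dotp (u + v) w = dotp u w + dotp v w.
Proof. by rewrite dotpC dotpDr !(dotpC w). Qed.

Lemma dotpZl a u v : dotp (a *: u) v = a * dotp u v.
Proof. by rewrite dotpC dotpZr dotpC. Qed.

Lemma dotpBl u v w : dotp (u - v) w = dotp u w - dotp v w.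
Proof. by rewrite dotpC dotpBr !(dotpC w). Qed.

Definition dotpE := (dotpBl, dotpBr, dotpDl, dotpDr, dotpZl, dotpZr).

Lemma dotp_ge0 u : 0 <= dotp u u.
Proof. by apply: sumr_ge0 => i _; rewrite -expr2 sqr_ge0. Qed.

Lemma sqr_enorm u : enorm u ^+ 2 = dotp u u.
Proof. by rewrite sqr_sqrtr// dotp_ge0. Qed.

Lemma enorm_ge0 u : 0 <= enorm u.
Proof. exact: sqrtr_ge0. Qed.

Lemma enormZ a u : enorm (a *: u) = `|a| * enorm u.
Proof.
by rewrite /enorm dotpZl dotpZr mulrA -expr2 sqrtrM ?sqr_ge0// sqrtr_sqr.
Qed.

(** The topology of row vectors comes from the sup norm, while the algorithm
    measures distances by [enorm]; this bound and [dotp_le_norm] transfer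
    boundedness from one norm to the other. *)
Lemma norm_le_enorm u : `|u| <= enorm u.
Proof.
rewrite [`|u|]mx_normrE; apply/bigmax_leP; split=> [|[i j] _ /=].
  exact: enorm_ge0.
rewrite -sqrtr_sqr ler_sqrt ?dotp_ge0// expr2 (ord1 i) /dotp (bigD1 j)//=.
by rewrite lerDl; apply: sumr_ge0 => k _; rewrite -expr2 sqr_ge0.
Qed.

Lemma norm_coord_le u j : `|u 0 j| <= `|u|.
Proof.
rewrite [leRHS]mx_normrE.
exact: (le_bigmax _ (fun i : 'I_1 * 'I_n => `|u i.1 i.2|) (ord0, j)).
Qed.

Lemma dotp_le_norm u : dotp u u <= n%:R * `|u| ^+ 2.
Proof.
rewrite -[X in X%:R]card_ord mulr_natl -sumr_const.
apply: ler_sum => j _; rewrite -expr2 -real_normK ?num_real//.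
by rewrite ler_pXn2r ?nnegrE// norm_coord_le.
Qed.

Lemma cauchy_schwarz u v : dotp u v <= enorm u * enorm v.
Proof.
set a := enorm u; set b := enorm v.
have a0 : 0 <= a := enorm_ge0 u; have b0 : 0 <= b := enorm_ge0 v.
have [a_eq0|a_neq0] := eqVneq a 0.
  have u0 : u = 0.
    apply/eqP; rewrite -normr_le0; apply: le_trans (norm_le_enorm u) _.
    by rewrite -/a a_eq0.
  by rewrite u0 -[0](scale0r u) dotpZl a_eq0 !mul0r.
have [b_eq0|b_neq0] := eqVneq b 0.
  have v0 : v = 0.
    apply/eqP; rewrite -normr_le0; apply: le_trans (norm_le_enorm v) _.
    by rewrite -/b b_eq0.
  by rewrite v0 -[0](scale0r v) dotpZr b_eq0 mul0r mulr0.
have ab0 : 0 < a * b by rewrite mulr_gt0// lt_neqAle eq_sym ?a_neq0 ?b_neq0.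
have := dotp_ge0 (b *: u - a *: v).
rewrite !dotpE (dotpC v u) -!sqr_enorm -/a -/b => h.
by rewrite -(ler_pM2l ab0); nra.
Qed.

Lemma dotp_continuous (g h : 'rV[R]_n -> 'rV[R]_n) :
  continuous g -> continuous h -> continuous (fun z => dotp (g z) (h z)).
Proof.
move=> cg ch; apply: continuous_big; first exact: add_continuous.
have coord (k : 'rV[R]_n -> 'rV[R]_n) i z :
    continuous k -> k x 0 i @[x --> z] --> k z 0 i.
  move=> ck.
  apply: (@cvg_comp _ _ _ k (fun v : 'rV[R]_n => v 0 i) _ _ _ (ck z)).
  exact: coord_continuous.
by move=> i _ z; exact: cvgM (coord g i z cg) (coord h i z ch).
Qed.

End DotProduct.

(** * Finite convex functions: continuity and the gradient inequality *)

Section ConvexFunctions.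
Context {R : realType}.

(** Convexity in the form used throughout: the convex-space combination is
    replaced by a point on the ray from [x] to [y]. *)
Lemma convex_segment (V : lmodType R) (g : V -> R) (x y : V) (t : R) :
  convex_function setT g -> 0 <= t <= 1 ->
  g (x + t *: (y - x)) <= g x + t * (g y - g x).
Proof.
move=> cg /andP[t0 t1].
have := cg (Itv01 t0 t1) y x (in_setT _) (in_setT _).
have -> : conv (Itv01 t0 t1) (y : convex_lmodType V) x = x + t *: (y - x) :> V.
  by rewrite /conv/= scalerBl scale1r scalerBr addrCA.
by have -> : g x + t * (g y - g x) = t * g y + (1 - t) * g x by ring.
Qed.

(** A convex function on a segment lies below its larger endpoint value; the
    sum of absolute values serves as a bound for both endpoints. *)
Lemma convex_le_line (V : lmodType R) (g : V -> R) (x v : V) (r : R) :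
  convex_function setT g -> 0 < r ->
  exists B, forall t, `|t| <= r -> g (x + t *: v) <= B.
Proof.
move=> cg r0; pose a := x - r *: v; pose b := a + (2 * r) *: v.
exists (`|g a| + `|g b|) => t; rewrite ler_norml => /andP[rt tr].
pose s := (t + r) / (2 * r).
have sE : s * (2 * r) = t + r by rewrite /s divfK//; lra.
have s01 : 0 <= s <= 1.
  by apply/andP; split; rewrite /s ?divr_ge0 ?ler_pdivrMr//; lra.
have -> : x + t *: v = a + s *: (b - a).
  rewrite /b [_ - a]addrAC subrr add0r scalerA sE /a.
  by rewrite scalerDl addrACA addNr addr0.
apply: le_trans (convex_segment _ _ cg s01) _.
have := ler_norm (g a); have := ler_norm (g b).
have := normr_ge0 (g a); have := normr_ge0 (g b); case/andP: s01; nra.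
Qed.

(** Induction on the directions: [x + (u + w)] is the midpoint of [x + 2 u]
    and [x + 2 w], so the box of radius [r] in one more direction is controlled
    by a segment and a smaller-dimensional box, both of radius [2 r]. *)
Lemma convex_le_box (V : lmodType R) (I : Type) (b : I -> V) (s : seq I)
    (g : V -> R) (x : V) (r : R) :
  convex_function setT g -> 0 < r ->
  exists B, forall d : I -> R, (forall i, `|d i| <= r) ->
    g (x + \sum_(i <- s) d i *: b i) <= B.
Proof.
move=> cg; elim: s r => [|i s IH] r r0.
  by exists (g x) => d _; rewrite big_nil addr0.
have r20 : 0 < 2 * r by rewrite mulr_gt0.
have [B1 B1P] := IH _ r20.
have [B2 B2P] := convex_le_line x (b i) cg r20.
have d2 (d : I -> R) : (forall i, `|d i| <= r) -> forall i, `|2 * d i| <= 2 * r.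
  by move=> dr j; rewrite normrM ger0_norm// ler_pM2l.
exists (`|B1| + `|B2|) => d dr; rewrite big_cons.
have := B1P _ (d2 _ dr); have := B2P _ (d2 _ dr i).
have sumE : \sum_(j <- s) (2 * d j) *: b j = 2 *: \sum_(j <- s) d j *: b j.
  by rewrite scaler_sumr; apply: eq_bigr => j _; rewrite scalerA.
rewrite /= sumE -scalerA; set u := d i *: b i; set w := \sum_(j <- s) _.
have -> : x + (u + w) = x + 2 *: u + 2^-1 *: (x + 2 *: w - (x + 2 *: u)).
  rewrite opprD addrACA subrr add0r -scalerBr scalerK//.
  by rewrite scaler_nat mulr2n -!addrA [u + (w - u)]addrC subrK.
move=> g2 g1; apply: le_trans (convex_segment _ _ cg _) _; first lra.
have := ler_norm B1; have := ler_norm B2.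
have := normr_ge0 B1; have := normr_ge0 B2; lra.
Qed.

Lemma convex_le_ball n (g : 'rV[R]_n -> R) (x : 'rV[R]_n) :
  convex_function setT g ->
  exists B, forall d, `|d| <= 1 -> g (x + d) <= B.
Proof.
move=> cg.
have [B BP] := convex_le_box (fun i : 'I_n => delta_mx 0 i)
  (index_enum 'I_n) x cg ltr01.
exists B => d d1; rewrite [d]row_sum_delta; apply: BP => i.
exact: le_trans (norm_coord_le d i) d1.
Qed.

(** Let [B] bound [g] on the unit ball around [x], and let [d = t u] with
    [t = |d|]. Since [x + d] is between [x] and [x + u], the value [g (x + d)]
    exceeds [g x] by at most [t (B - g x)]. Since [x] is between [x + d] and
    [x - u], it cannot fall below [g x] by more than the same amount. *)
Lemma convex_continuous n (g : 'rV[R]_n -> R) :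
  convex_function setT g -> continuous g.
Proof.
move=> cg x; have [B BP] := convex_le_ball x cg.
pose c := B - g x.
have c0 : 0 <= c by rewrite subr_ge0 -[x in g x]addr0 BP// normr0.
have key d : `|d| <= 1 -> `|g (x + d) - g x| <= `|d| * c.
  move=> d1; have [->|d_neq0] := eqVneq d 0.
    by rewrite addr0 subrr !normr0 mul0r.
  set t := `|d| in d1 *; have t0 : 0 < t by rewrite normr_gt0.
  have u1 : `|t^-1 *: d| <= 1.
    by rewrite normrZ normfV normr_id mulVf ?normr_eq0.
  have up := BP _ u1.
  have dn := BP (- (t^-1 *: d)); rewrite normrN in dn; have {}dn := dn u1.
  set u := t^-1 *: d in up dn.
  have dE : d = t *: u by rewrite scalerA divff ?scale1r// gt_eqF.
  clearbody u t.
  have t01 : 0 <= t <= 1 by rewrite ltW.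
  have g1 := convex_segment x (x + u) cg t01.
  rewrite addrAC subrr add0r -dE in g1.
  have s01 : 0 <= t / (1 + t) <= 1.
    apply/andP; split; first by rewrite divr_ge0; lra.
    by rewrite ler_pdivrMr; lra.
  have g2 := convex_segment (x + d) (x - u) cg s01.
  have xE : x + d + t / (1 + t) *: (x - u - (x + d)) = x.
    have -> : x - u - (x + d) = - ((1 + t) *: u).
      by rewrite opprD addrACA subrr add0r dE scalerDl scale1r opprD.
    by rewrite scalerN scalerA divfK ?dE ?addrK//; lra.
  rewrite xE in g2.
  have {}g2 : (1 + t) * g x <= g (x + d) + t * g (x - u).
    have -> : g (x + d) + t * g (x - u) =
      (1 + t) * (g (x + d) + t / (1 + t) * (g (x - u) - g (x + d))).
      by field; lra.
    by rewrite ler_pM2l//; lra.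
  by rewrite ler_norml; apply/andP; split; rewrite /c; nra.
apply/(@cvgrPdist_le _ _ _ (nbhs x)) => e e0.
have c1 : 0 < c + 1 by lra.
apply/nbhs_ballP; exists (Num.min 1 (e / (c + 1))) => /=.
  by rewrite lt_min ltr01 divr_gt0.
move=> y; rewrite -ball_normE/= lt_min => /andP[/ltW y1 /ltW ye].
rewrite distrC in y1; have := key _ y1.
rewrite [x + _]addrC subrK [`|g x - _|]distrC => /le_trans; apply.
rewrite ler_pdivlMr// distrC in ye.
by have := normr_ge0 (y - x); nra.
Qed.

(** The difference quotients [(f (x + h (y - x)) - f x) / h] are at most
    [f y - f x] for [0 < h <= 1], hence so is their limit as [h] tends to 0,
    which is the derivative of [f] at [x] in the direction [y - x]. *)
Lemma convex_gradient_le n (f : 'rV[R]_n -> R) (x y : 'rV[R]_n) :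
  convex_function setT f -> differentiable f x ->
  f x + dotp (grad f x) (y - x) <= f y.
Proof.
move=> cf df.
have -> : dotp (grad f x) (y - x) = 'D_(y - x) f x.
  rewrite deriveE// [X in 'd f x X]row_sum_delta linear_sum.
  by apply: eq_bigr => i _; rewrite linearZ/= mxE deriveE// mulrC.
rewrite addrC -lerBrDr leNgt; apply/negP => lt_D.
have cD : h^-1 *: ((f \o shift x) (h *: (y - x)) - f x) @[h --> 0^'] -->
    'D_(y - x) f x by exact: diff_derivable.
have := @cvgr_gt R R _ (dnbhs_filter (0 : R)) _ _ cD _ lt_D.
rewrite near_withinE => /nbhs_ballP[e /= e0 eP].
pose h := Num.min 1 (e / 2).
have h0 : 0 < h by rewrite lt_min ltr01 divr_gt0.
have he : h < e by rewrite /h minElt; case: ifP => //; lra.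
have h1 : h <= 1 by rewrite ge_min lexx.
have := eP h; rewrite -ball_normE/= sub0r normrN gtr0_norm// => /(_ he).
rewrite gt_eqF// => /(_ isT).
have h01 : 0 <= h <= 1 by rewrite ltW.
have := convex_segment x y cf h01.
rewrite [x + _]addrC mulrC -lerBlDl -ler_pdivrMr// [_ / h]mulrC.
by move=> /le_lt_trans/[apply]; rewrite ltxx.
Qed.

End ConvexFunctions.

(** * Two tools for minimizers *)

Section Minimizers.
Context {R : realType} {n : nat}.

Lemma compact_argmin (A : set 'rV[R]_n) (g : 'rV[R]_n -> R) (a : 'rV[R]_n) :
  compact A -> continuous g -> A a ->
  (forall z, ~ A z -> g a <= g z) ->
  exists2 z, A z & is_argmin g z.
Proof.
move=> cA cg Aa out.
have [||z zA zmin] := EVT_min_rV (A := A) _ cA (f := g).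
- by exists a.
- exact: continuous_subspaceT.
exists z; first by rewrite inE in zA.
move=> y; have [Ay|nAy] := pselect (A y); first by apply: zmin; rewrite inE.
by apply: le_trans (out _ nAy); apply: zmin; rewrite inE.
Qed.

(** This replaces the passage to the limit [t -> 0] in first-order optimality
    conditions. If [a < 0], the value [t = - a / (2 (|a| + |b|))] gives a
    contradiction. *)
Lemma affine_ge0 (a b : R) :
  (forall t, 0 < t <= 1 -> 0 <= a + t * b) -> 0 <= a.
Proof.
move=> h; rewrite leNgt; apply/negP => a0.
pose t := - a / (2 * (`|a| + `|b|)).
have ab0 : 0 < `|a| + `|b| by rewrite ltr_pwDl ?normr_gt0 ?lt_eqF.
have tE : t * (2 * (`|a| + `|b|)) = - a by rewrite divfK//; lra.
have na : `|a| = - a by rewrite ltr0_norm.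
have t0 : 0 < t by rewrite divr_gt0; lra.
have b0 := normr_ge0 b; have bb := ler_norm b.
have t1 : t <= 1 by rewrite ler_pdivrMr; lra.
have := h t; rewrite t0 t1 => /(_ isT).
nra.
Qed.

End Minimizers.

(** * The subproblem minimized at each iteration *)

Section Model.
Context {R : realType} {n : nat}.
Variables (f psi : 'rV[R]_n -> R).
Hypothesis psi_convex : convex_function setT psi.

Lemma sparsa_model_continuous x alpha :
  continuous (sparsa_model f psi x alpha).
Proof.
have ccst (c : 'rV[R]_n) : continuous (fun _ : 'rV[R]_n => c).
  exact: cst_continuous.
have cid : continuous (fun y : 'rV[R]_n => y) by move=> y.
have csub : continuous (fun y : 'rV[R]_n => y - x).
  by move=> y; exact: cvgB (cid y) (ccst x y).
have cgrad := dotp_continuous (ccst (grad f x)) cid.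
have cdist := dotp_continuous csub csub.
have -> : sparsa_model f psi x alpha = (fun z =>
    dotp (grad f x) z + alpha * dotp (z - x) (z - x) + psi z).
  by apply/funext => z; rewrite /sparsa_model sqr_enorm.
move=> z; apply: (cvgD (cvgD (cgrad z) (cvgM (cvg_cst alpha) (cdist z)))).
exact: convex_continuous.
Qed.

(** First-order optimality: [- grad f x - 2 alpha (z - x)] is a subgradient of
    [psi] at the minimizer [z]. It follows by comparing [z] with the points
    [z + t (y - z)], using convexity for [psi], and letting [t] tend to 0. *)
Lemma argmin_subgradient x alpha z y :
  is_argmin (sparsa_model f psi x alpha) z ->
  psi z <= psi y + dotp (grad f x) (y - z) + 2 * alpha * dotp (z - x) (y - z).
Proof.
move=> zmin; rewrite -subr_ge0.
apply: (affine_ge0 (b := alpha * dotp (y - z) (y - z))) => t /andP[t0 t1].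
rewrite -(pmulr_rge0 _ t0).
have t01 : 0 <= t <= 1 by rewrite ltW.
have := convex_segment z y psi_convex t01.
have := zmin (z + t *: (y - z)).
rewrite /sparsa_model !sqr_enorm (addrAC z).
move: (y - z) (z - x) => d s.
by rewrite !(dotpDr, dotpDl) !(dotpZl, dotpZr) (dotpC d s); nra.
Qed.

(** The subgradient of [psi] at a minimizer for [alpha] makes the model for any
    other parameter [alpha'] grow quadratically away from that minimizer, up to
    a linear error caused by the change of parameter. *)
Lemma sparsa_model_growth x alpha alpha' z y :
  is_argmin (sparsa_model f psi x alpha) z ->
  sparsa_model f psi x alpha' z + alpha' * dotp (y - z) (y - z) <=
  sparsa_model f psi x alpha' y + 2 * (alpha - alpha') * dotp (z - x) (y - z).
Proof.
move=> /(argmin_subgradient y); rewrite /sparsa_model !sqr_enorm.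
have -> : y - x = (z - x) + (y - z) by rewrite [RHS]addrC subrKA.
rewrite [dotp (grad f x) _]dotpBr.
move: (y - z) (z - x) => d s.
by rewrite !(dotpDr, dotpDl) (dotpC d s); nra.
Qed.

(** Step 2 of the algorithm rejects [alpha] also when the model has no
    minimizer. This rules the case out: as soon as the model has a minimizer for
    one parameter, it is coercive for every positive parameter, so it attains
    its minimum on a closed ball. *)
Lemma sparsa_model_has_argmin x alpha alpha' z :
  is_argmin (sparsa_model f psi x alpha) z -> 0 < alpha' ->
  exists z', is_argmin (sparsa_model f psi x alpha') z'.
Proof.
move=> zmin a'0.
(* Outside this radius the quadratic growth dominates the linear error. *)
pose r := 2 * `|alpha - alpha'| * enorm (z - x) / alpha'.
have r0 : 0 <= r.
  by rewrite divr_ge0 ?mulr_ge0 ?enorm_ge0 ?normr_ge0// ltW.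
have cB : compact (closed_ball_ Num.Def.normr z r).
  apply: bounded_closed_compact.
    exists (`|z| + r); split; first exact: num_real.
    move=> M /ltW zM y; rewrite /closed_ball_/= => zy; apply: le_trans zM.
    by rewrite -lerBlDl; apply: le_trans (lerB_dist y z) _; rewrite distrC.
  exact: closed_closed_ball_.
have Bz : (closed_ball_ Num.Def.normr z r) z.
  by rewrite /closed_ball_/= subrr normr0.
have [|z' _ z'min] := compact_argmin cB (@sparsa_model_continuous x alpha') Bz.
  move=> y /negP; rewrite -ltNge distrC => ry.
  have := sparsa_model_growth alpha' y zmin.
  have ed : r < enorm (y - z) := lt_le_trans ry (norm_le_enorm _).
  have cs : 2 * (alpha - alpha') * dotp (z - x) (y - z) <=
     r * alpha' * enorm (y - z).
    rewrite /r divfK ?gt_eqF// -!mulrA ler_pM2l// !mulrA.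
    have := cauchy_schwarz (z - x) (y - z).
    have := cauchy_schwarz (- (z - x)) (y - z).
    rewrite -scaleN1r dotpZl enormZ normrN1 mul1r mulN1r -mulrA.
    set w := enorm _ * _; case: ger0P; nra.
  rewrite -sqr_enorm; move: (enorm (y - z)) ed cs => e ed cs growth.
  have : 0 <= alpha' * (e * (e - r)).
    by rewrite !mulr_ge0 ?subr_ge0 ?ltW//; exact: le_lt_trans ed.
  move: cs growth; lra.
by exists z'.
Qed.

End Model.

(** * One iteration *)

Section SpaRSAStep.
Context {R : realType} {n : nat}.
Variables (f psi phi : 'rV[R]_n -> R) (K : set 'rV[R]_n) (L : R).
Hypothesis phiE : forall z, phi z = f z + psi z.
Hypothesis f_differentiable : forall x, differentiable f x.
Hypothesis f_convex : convex_function setT f.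
Hypothesis psi_convex : convex_function setT psi.
Hypothesis L_ge0 : 0 <= L.
Hypothesis f_lipschitz : forall x y, K x -> K y ->
  enorm (grad f x - grad f y) <= L * enorm (x - y).

(** The descent lemma with [L] in place of [L / 2]. For convex [f] it needs no
    integration along the segment from [x] to [y]: the gradient inequality at
    [y] bounds [f y - f x] by [<grad f y, y - x>], and changing [grad f y] into
    [grad f x] costs at most [L |y - x| ^ 2]. *)
Lemma convex_descent x y : K x -> K y ->
  f y <= f x + dotp (grad f x) (y - x) + L * dotp (y - x) (y - x).
Proof.
move=> Kx Ky.
have gi := convex_gradient_le x f_convex (f_differentiable y).
have cs := cauchy_schwarz (grad f y - grad f x) (y - x).
have lip := f_lipschitz Ky Kx.
have e0 := enorm_ge0 (y - x).
have : dotp (grad f y - grad f x) (y - x) <= L * dotp (y - x) (y - x).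
  rewrite -sqr_enorm; apply: (le_trans cs).
  by rewrite expr2 mulrA ler_wpM2r.
rewrite -(opprB y x) -scaleN1r dotpZr in gi.
rewrite dotpBl; lra.
Qed.

(** Comparing the minimizer [z] of the model with [x] itself bounds
    [<grad f x, z - x> + psi z - psi x] by [- alpha |z - x| ^ 2]. The descent
    lemma adds at most [L t ^ 2 |z - x| ^ 2], and [t ^ 2 <= t]. *)
Lemma trial_segment_decrease x z alpha t :
  is_argmin (sparsa_model f psi x alpha) z -> 0 <= t <= 1 ->
  K x -> K (x + t *: (z - x)) ->
  phi (x + t *: (z - x)) <=
    phi x - t * (alpha - L) * dotp (z - x) (z - x).
Proof.
move=> zmin t01 Kx Ky.
have := convex_descent Kx Ky.
have := convex_segment x z psi_convex t01.
have := zmin x; rewrite /sparsa_model !sqr_enorm subrr.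
rewrite [x + _ - x]addrAC subrr add0r !phiE.
have -> : dotp (0 : 'rV[R]_n) 0 = 0.
  by rewrite -[X in dotp X](scale0r 0) dotpZl mul0r.
have -> : dotp (grad f x) z = dotp (grad f x) x + dotp (grad f x) (z - x).
  by rewrite dotpBr; lra.
have := dotp_ge0 (z - x).
move: (x + _) => y; move: (z - x) => s S0 zx psiy fy.
rewrite !dotpZr !dotpZl in fy.
move: (dotp s s) S0 zx fy => S S0 zx fy.
case/andP: t01 => t0 t1.
have : 0 <= t * (1 - t) * (L * S) by rewrite !mulr_ge0 ?subr_ge0.
have : 0 <= t * (psi x - psi z - dotp (grad f x) s - alpha * S).
  by rewrite mulr_ge0//; lra.
nra.
Qed.

(** The Lipschitz estimate holds on [K] only, so the trial point must be shown
    to lie there. Take the last parameter [t] in [0, 1] for which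
    [x + t (z - x)] belongs to [K]. There [phi] has not increased, so this point
    is in the level set of [phi x] and thus interior to [K]. If [t < 1], the path
    could be continued inside [K]; hence [t = 1]. *)
Lemma trial_point_in_compact x z alpha :
  compact K -> level_set phi (phi x) `<=` interior K ->
  is_argmin (sparsa_model f psi x alpha) z -> L <= alpha -> K z.
Proof.
move=> cK lev zmin La.
have Kx : K x by apply: interior_subset; apply: lev; rewrite /level_set/=.
pose path (t : R) := x + t *: (z - x).
have cpath : continuous path.
  move=> t; apply: cvgD; first exact: cst_continuous.
  by apply: cvgZ; [exact: cvg_id|exact: cst_continuous].
pose T := `[0, 1]%classic `&` path @^-1` K.
have cT : compact T.
  apply: (subclosed_compact _ (@segment_compact R 0 1)); last by move=> t [].
  apply: closedI; first exact: itv_closed.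
  apply: preimage_closed => [t _|]; first exact: cpath.
  by apply: compact_closed => //; exact: norm_hausdorff.
have T0 : T 0.
  split; first by rewrite /= in_itv/= lexx ler01.
  by rewrite /path/preimage/= scale0r addr0.
have [||t] := compact_EVT_max (A := T) (f := id) _ cT.
- by exists 0.
- by apply: continuous_subspaceT => t; exact: cvg_id.
rewrite inE => -[]; rewrite /= in_itv/= => t01 Kt tmax.
have /lev Kt' : level_set phi (phi x) (path t).
  rewrite /level_set/=.
  apply: le_trans (trial_segment_decrease zmin t01 Kx Kt) _.
  by rewrite gerBl !mulr_ge0 ?dotp_ge0 ?subr_ge0//; case/andP: t01.
have [t1|t1] := eqVneq t 1.
  by move: Kt; rewrite /path t1 scale1r addrC subrK.
have {}t1 : t < 1 by rewrite lt_neqAle t1; case/andP: t01.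
have /nbhs_ballP[e /= e0 eP] : nbhs t (path @^-1` K) by exact: cpath.
pose u := Num.min 1 (t + e / 2).
have tu : t < u by rewrite lt_min t1 ltrDl divr_gt0.
have : u \in T.
  rewrite inE; split.
    rewrite /= in_itv/= ge_min lexx andbT ltW//.
    by apply: le_lt_trans tu; case/andP: t01.
  apply: eP; rewrite -ball_normE/= distrC gtr0_norm ?subr_gt0//.
  by rewrite ltrBlDl /u gt_min; apply/orP; right; rewrite ltrD2l; lra.
by move=> /tmax/(lt_le_trans tu); rewrite ltxx.
Qed.

Variables (eta sigma alphamin alphamax : R).
Hypothesis eta_gt1 : 1 < eta.
Hypothesis sigma01 : 0 < sigma < 1.
Hypothesis alphamin_gt0 : 0 < alphamin.
Hypothesis K_compact : compact K.

(** With the full step [t = 1] the decrease is [(alpha - L) |z - x| ^ 2], which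
    is at least the required [sigma alpha |z - x| ^ 2] as soon as
    [L <= alpha (1 - sigma)]. *)
Lemma large_alpha_accepted r x z alpha :
  level_set phi (phi x) `<=` interior K -> phi x <= r ->
  is_argmin (sparsa_model f psi x alpha) z ->
  L / (1 - sigma) <= alpha -> sparsa_accept f psi sigma r x alpha z.
Proof.
move=> lev xr zmin La'; case/andP: sigma01 => s0 s1.
have a0 : 0 <= alpha by apply: le_trans La'; rewrite divr_ge0//; lra.
have La : L <= alpha * (1 - sigma) by rewrite -ler_pdivrMr ?subr_gt0.
have Kx : K x by apply: interior_subset; apply: lev; rewrite /level_set/=.
have Kz : K z by apply: trial_point_in_compact zmin _ => //; nra.
split=> //; rewrite -phiE sqr_enorm.
have := @trial_segment_decrease x z alpha 1 zmin; rewrite ler01 lexx.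
rewrite scale1r addrC subrK => /(_ isT Kx Kz).
by have := dotp_ge0 (z - x); nra.
Qed.

(** A parameter larger than [alphamax] results from at least one multiplication
    by [eta] after a rejection, and rejected parameters are below
    [L / (1 - sigma)]. The sum is used instead of the maximum of the two
    resulting bounds. *)
Definition alpha_bound := alphamax + eta * (L / (1 - sigma)).

Lemma sparsa_step_alpha r x x' :
  level_set phi (phi x) `<=` interior K -> phi x <= r ->
  sparsa_step f psi eta sigma alphamin alphamax r x x' ->
  exists2 alpha, alphamin <= alpha <= alpha_bound &
    sparsa_accept f psi sigma r x alpha x'.
Proof.
move=> lev xr [alpha0 /andP[lea0 gea0] [j acc rej]].
exists (eta ^+ j * alpha0) => //.
have eta0 : 0 < eta := lt_trans ltr01 eta_gt1.
case/andP: sigma01 => s0 s1.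
have l0 : 0 <= L / (1 - sigma) by rewrite divr_ge0//; lra.
have a0 : 0 < alpha0 := lt_le_trans alphamin_gt0 lea0.
apply/andP; split.
  apply: (le_trans lea0); rewrite ler_peMl//; first exact: ltW.
  by rewrite exprn_ege1// ltW.
case: j acc rej => [|i] acc rej.
  by rewrite expr0 mul1r /alpha_bound; nra.
have [z zmin] := sparsa_model_has_argmin psi_convex (proj1 acc)
  (mulr_gt0 (exprn_gt0 i eta0) a0).
have [small|large] := leP (L / (1 - sigma)) (eta ^+ i * alpha0).
  have [] := rej i (ltnSn i).
  by exists z; exact: large_alpha_accepted.
by rewrite exprS -mulrA /alpha_bound; nra.
Qed.

(** Bound [phi x'] by the model at [x'] using the descent lemma, replace [x'] by
    the point [z = x + t (y - x)] using minimality, and return from the model to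
    [phi z] using the gradient inequality. What remains is convexity of [phi]
    between [x] and [y]; the theorem takes for [y] a minimizer of [phi]. *)
Lemma sparsa_accept_model_bound r x x' alpha y t :
  sparsa_accept f psi sigma r x alpha x' -> 0 <= alpha -> 0 <= t <= 1 ->
  K x -> K x' ->
  phi x' <= phi x + t * (phi y - phi x) +
    alpha * t ^+ 2 * dotp (y - x) (y - x) + L * dotp (x' - x) (x' - x).
Proof.
move=> [x'min _] a0 t01 Kx Kx'.
pose z := x + t *: (y - x).
have phi_convex : phi z <= phi x + t * (phi y - phi x).
  have := convex_segment x y f_convex t01.
  by have := convex_segment x y psi_convex t01; rewrite -/z !phiE; lra.
have gz := convex_gradient_le z f_convex (f_differentiable x).
have dx' := convex_descent Kx Kx'.
have zx : z - x = t *: (y - x) by rewrite /z addrAC subrr add0r.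
have := x'min z; rewrite /sparsa_model !sqr_enorm zx dotpZl dotpZr.
rewrite !phiE in phi_convex *; rewrite !(dotpBr (grad f x)) in gz dx'.
have := mulr_ge0 a0 (dotp_ge0 (x' - x)); lra.
Qed.

End SpaRSAStep.

(** * The reference value *)

Section ReferenceValue.
Context {R : realType} {n : nat}.
Variables (phi : 'rV[R]_n -> R) (x : nat -> 'rV[R]_n) (M : nat).

Lemma gll_reference_ge k : phi (x k) <= gll_reference phi x M k.
Proof. exact: bigmax_ge_id. Qed.

(** Working with an index at which the maximum is attained avoids any further
    manipulation of iterated maxima. *)
Lemma gll_reference_attained k : (1 <= k)%N -> (1 <= M)%N ->
  exists2 i, [&& 1 <= i, i <= k & k < i + M]%N &
    gll_reference phi x M k = phi (x i).
Proof.
move=> k1 M1; rewrite /gll_reference big_seq.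
apply: (big_ind (fun v =>
  exists2 i, [&& 1 <= i, i <= k & k < i + M]%N & v = phi (x i))).
- by exists k => //; lia.
- move=> _ _ [i iP ->] [j jP ->]; rewrite /Num.max.
  by case: ifP => _; [exists j|exists i].
- move=> j; rewrite mem_index_iota => /andP[_ jlt].
  by exists (k - j)%N => //; lia.
Qed.

End ReferenceValue.

(** * From a quadratic decrease to a sublinear rate *)

Section Rate.
Context {R : realFieldType}.

(** Strong induction on [k], for [g e k k <= M]. When [k <= 3 M] the a priori
    bound [g e k <= 1 / 4] is enough. Otherwise the index [i] in the window is at
    least [2 M], so [u = M / i <= 1 / 2] lies in the range where [h - h ^ 2] is
    increasing, and the induction hypothesis [g e i <= u] gives
    [g e k <= u - u ^ 2]. As [k <= i + M], multiplying by [k] yields at most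
    [(u - u ^ 2) (i + M) = M (1 - u ^ 2) <= M]. *)
Lemma windowed_quadratic_decrease_rate (e : nat -> R) (g : R) (M : nat) :
  (1 <= M)%N -> 0 < g -> (forall k, (1 <= k)%N -> 4 * g * e k <= 1) ->
  (forall k, (1 <= k)%N ->
    exists2 i, [&& 1 <= i, i <= k & k < i + M]%N &
      e k.+1 <= e i - g * e i ^+ 2) ->
  forall k, (1 <= k)%N -> e k <= M%:R / g / k%:R.
Proof.
move=> M1 g0 e_le dec k; elim/ltn_ind: k => k IH k1.
have k0 : 0 < k%:R :> R by rewrite ltr0n.
rewrite ler_pdivlMr// ler_pdivlMr//.
have ek := e_le _ k1.
have [kM|Mk] := leqP k (3 * M).
  have : k%:R <= 3 * M%:R :> R by rewrite -natrM ler_nat.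
  have : 0 <= M%:R :> R by [].
  nra.
case: k IH k1 k0 ek Mk => // k IH _ k0 _ Mk.
have k1 : (1 <= k)%N by lia.
have [i /and3P[i1 ik kiM] ei] := dec k k1.
have := IH i (leq_ltn_trans ik (ltnSn k)) i1.
have i0 : 0 < i%:R :> R by rewrite ltr0n.
rewrite ler_pdivlMr// ler_pdivlMr// => eii.
have kM : k.+1%:R <= i%:R + M%:R :> R by rewrite -natrD ler_nat.
have iM : 2 * M%:R <= i%:R :> R by rewrite -natrM ler_nat; lia.
move: k0 kM; set q : R := k.+1%:R; move: (e k.+1) ei => e1 ei k0 kM.
have m0 : 0 <= M%:R :> R by [].
pose h := g * e i.
have {}ei : e1 * g <= h - h ^+ 2.
  by have := ler_wpM2r (ltW g0) ei; rewrite /h; lra.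
pose u := M%:R / i%:R : R.
have ui : u * i%:R = M%:R by rewrite divfK// gt_eqF.
have u0 : 0 <= u by rewrite divr_ge0// ltW.
have u2 : u <= 2^-1 by rewrite ler_pdivrMr//; lra.
have hu : h <= u by rewrite ler_pdivlMr// /h; lra.
have hu2 : h - h ^+ 2 <= u - u ^+ 2.
  have : 0 <= (u - h) * (1 - u - h) by rewrite mulr_ge0; lra.
  lra.
have uu : 0 <= u - u ^+ 2 by nra.
have : e1 * g * q <= (u - u ^+ 2) * (i%:R + M%:R).
  apply: le_trans (ler_wpM2l uu kM).
  by rewrite ler_pM2r//; exact: le_trans hu2.
have -> : (u - u ^+ 2) * (i%:R + M%:R) = M%:R - u ^+ 2 * M%:R.
  by rewrite -ui; ring.
have := mulr_ge0 (sqr_ge0 u) m0; lra.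
Qed.

(** Here [e0], [e1] and [E] stand for the errors at the current iterate, at the
    next one, and at the reference iterate; [S] is the error term due to the step
    length, which the acceptance test bounds by the decrease itself. The choice
    [t = E / (2 C)] balances the linear gain [t E] against the quadratic loss
    [t ^ 2 C]. *)
Lemma quadratic_decrease (e0 e1 E b c C S : R) :
  0 < c -> 0 <= E -> 0 < C -> E <= C -> b <= C ->
  e0 <= E -> S <= c * (E - e1) ->
  (forall t, 0 <= t <= 1 -> e1 <= (1 - t) * e0 + t ^+ 2 * b + S) ->
  e1 <= E - (4 * C * (1 + c))^-1 * E ^+ 2.
Proof.
move=> c0 E0 C0 EC bC e0E SE step.
pose t := E / (2 * C).
have tC : t * (2 * C) = E by rewrite divfK//; lra.
have t0 : 0 <= t by rewrite divr_ge0//; lra.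
have t1 : t <= 1 by rewrite ler_pdivrMr; lra.
have := step t; rewrite t0 t1 => /(_ isT) e1_le.
have -> : (4 * C * (1 + c))^-1 * E ^+ 2 = C * t ^+ 2 / (1 + c).
  by rewrite -tC; field; lra.
have c1 : 0 < 1 + c by lra.
rewrite -(ler_pM2r c1) mulrBl divfK ?gt_eqF//.
have : t ^+ 2 * b <= t ^+ 2 * C by rewrite ler_wpM2l// sqr_ge0.
have : (1 - t) * e0 <= (1 - t) * E by rewrite ler_wpM2l//; lra.
have : t * E = 2 * C * t ^+ 2 by rewrite -tC; ring.
lra.
Qed.

End Rate.

(** * The convergence rate *)

Lemma compact_dotp_bounded (R : realType) n (K : set 'rV[R]_n) :
  compact K -> exists2 D : R, 0 <= D &
    forall u v, K u -> K v -> dotp (u - v) (u - v) <= D.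
Proof.
move=> /compact_bounded[N [_ KN]].
have leN u : K u -> `|u| <= `|N| + 1.
  by move=> Ku; apply: (KN (`|N| + 1)) => //; have := ler_norm N; lra.
exists (n%:R * (2 * (`|N| + 1)) ^+ 2); first by rewrite mulr_ge0 ?sqr_ge0.
move=> u v /leN Nu /leN Nv; apply: le_trans (dotp_le_norm _) _.
rewrite ler_wpM2l// ler_pXn2r ?nnegrE//.
by apply: le_trans (ler_normB u v) _; lra.
Qed.

Theorem theorem3p2 (R : realType) (n : nat) (f psi phi : 'rV[R]_n -> R)
    (eta sigma alphamin alphamax : R) (M : nat)
    (phiR : nat -> R) (x : nat -> 'rV[R]_n) (K : set 'rV[R]_n)
    (phiE : forall z, phi z = f z + psi z)
    (f_smooth : continuously_differentiable f)
    (eta_gt1 : 1 < eta) (sigma01 : 0 < sigma < 1)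
    (alphamin_gt0 : 0 < alphamin) (alphaminmax : alphamin <= alphamax)
    (M_ge1 : (1 <= M)%N)
    (run : sparsa_infinite_run f psi eta sigma alphamin alphamax phiR x)
    (K_compact : compact K) (K_convex : convex_set K)
    (level_sub : level_set phi (phi (x 1%N)) `<=` interior K)
    (f_lipschitz : lipschitz_grad_on K f)
    (psi_convex : convex_function setT psi)
    (f_convex : convex_function setT f)
    (phiR_gll : forall k, (1 <= k)%N -> phiR k = gll_reference phi x M k) :
  exists2 phistar : R, is_minimum phi phistar &
  exists a b : R, \forall k \near \oo, phi (x k) - phistar <= a / (b + k%:R).
Proof.
have [f_diff _] := f_smooth.
have [L L_ge0 f_lip] : exists2 L : R, 0 <= L & forall y z, K y -> K z ->
    enorm (grad f y - grad f z) <= L * enorm (y - z).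
  case: f_lipschitz => L0 lip; exists `|L0| => // y z Ky Kz.
  by apply: le_trans (lip y z Ky Kz) _; rewrite ler_wpM2r ?enorm_ge0 ?ler_norm.
have inK y : phi y <= phi (x 1%N) -> K y.
  by move=> ?; apply: interior_subset; exact: level_sub.
have Kx1 : K (x 1%N) by exact: inK.
have phi_cont : continuous phi.
  have -> : phi = (fun z => f z + psi z) by exact/funext.
  have cf := convex_continuous f_convex.
  have cpsi := convex_continuous psi_convex.
  by move=> z; apply: (cvgD (cf z) (cpsi z)).
have [|zs Kzs zs_min] := compact_argmin K_compact phi_cont Kx1.
  move=> z; case: (leP (phi (x 1%N)) (phi z)) => // /ltW/inK; tauto.
exists (phi zs); first by exists zs.
set beta := alpha_bound L eta sigma alphamax.
have step k : (1 <= k)%N -> phi (x k) <= phi (x 1%N) ->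
    exists i alpha, [/\ [&& 1 <= i, i <= k & k < i + M]%N,
      phi (x k) <= phi (x i), alphamin <= alpha <= beta &
      sparsa_accept f psi sigma (phi (x i)) (x k) alpha (x k.+1)].
  move=> k1 lek.
  have [i iP iE] := gll_reference_attained phi x k1 M_ge1.
  have ge_ref := gll_reference_ge phi x M k.
  have lev : level_set phi (phi (x k)) `<=` interior K.
    by move=> z zk; apply: level_sub; exact: le_trans lek.
  have [] := run k k1; rewrite phiR_gll// iE => st _; rewrite iE in ge_ref.
  have [alpha ab acc] := sparsa_step_alpha phiE f_diff f_convex psi_convex
    L_ge0 f_lip eta_gt1 sigma01 alphamin_gt0 K_compact lev ge_ref st.
  by exists i, alpha; split.
have [s0 s1] := andP sigma01.
have decrease r y alpha z : alphamin <= alpha ->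
    sparsa_accept f psi sigma r y alpha z ->
    phi z <= r - sigma * alphamin * dotp (z - y) (z - y).
  move=> aa [_]; rewrite -phiE sqr_enorm => /le_trans; apply.
  by rewrite lerB// ler_wpM2r ?dotp_ge0// ler_wpM2l// ltW.
have sa0 : 0 < sigma * alphamin by rewrite mulr_gt0.
(* The iterates never leave the initial level set: each value is below an
   earlier one, although the sequence of values need not be monotone. *)
have le_x1 k : (1 <= k)%N -> phi (x k) <= phi (x 1%N).
  elim/ltn_ind: k => -[//|[//|k]] IH _.
  have [i [alpha [/and3P[i1 ik _] _ /andP[aa _] acc]]] :=
    step k.+1 isT (IH k.+1 (ltnSn _) isT).
  apply: le_trans (decrease _ _ _ _ aa acc) (le_trans _ (IH i _ i1)) => //.
  by rewrite gerBl mulr_ge0 ?dotp_ge0// ltW.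
have [D D0 DP] := compact_dotp_bounded K_compact.
pose e k := phi (x k) - phi zs.
have e_ge0 k : 0 <= e k by rewrite subr_ge0; exact: zs_min.
(* The summand 1 only makes [c] positive when [L = 0]. *)
pose c := L / (sigma * alphamin) + 1.
have c0 : 0 < c by rewrite /c ltr_wpDl// divr_ge0// ltW.
have beta0 : 0 <= beta.
  by have [i [alpha [_ _ /andP[aa ab] _]]] := step 1%N isT (lexx _); lra.
(* [C] dominates both the errors, as [quadratic_decrease] needs [t <= 1], and
   the quadratic coefficient [beta * D]. *)
pose C := e 1%N + beta * D + 1.
have bD0 := mulr_ge0 beta0 D0.
have C0 : 0 < C by rewrite /C; have := e_ge0 1%N; lra.
have e_leC k : (1 <= k)%N -> e k <= C.
  by move=> k1; have := le_x1 k k1; rewrite /C /e; lra.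
pose g := (4 * C * (1 + c))^-1.
have c1 : 0 < 1 + c by lra.
have g0 : 0 < g by rewrite invr_gt0 !mulr_gt0.
exists (M%:R / g), 0; exists 1%N => // k /= k1; rewrite add0r.
apply: (windowed_quadratic_decrease_rate (e := e)) => // [{}k {}k1|{}k {}k1].
  rewrite /g mulrAC ler_pdivrMr ?mulr_gt0// mul1r -mulrA ler_pM2l//.
  apply: le_trans (e_leC k k1) _; rewrite ler_peMr//; lra.
have [i [alpha [iP xki /andP[aa ab] acc]]] := step k k1 (le_x1 k k1).
exists i => //; have [i1 _ _] := and3P iP.
have Kxk := inK _ (le_x1 k k1).
have Kxk1 := inK _ (le_x1 k.+1 isT).
have dec := decrease _ _ _ _ aa acc.
apply: (@quadratic_decrease _ (e k) _ _ (beta * D) c C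
  (L * dotp (x k.+1 - x k) (x k.+1 - x k))) => //.
- exact: e_leC.
- by rewrite /C; have := e_ge0 1%N; lra.
- by rewrite /e lerB.
- move: (dotp _ _) (dotp_ge0 (x k.+1 - x k)) dec => S S0 dec.
  have SE : sigma * alphamin * S <= e i - e k.+1 by rewrite /e; lra.
  have E0 : 0 <= e i - e k.+1.
    by apply: le_trans SE; rewrite mulr_ge0// ltW.
  rewrite /c mulrDl mul1r.
  have -> : L * S = L / (sigma * alphamin) * (sigma * alphamin * S).
    by rewrite mulrA divfK// gt_eqF.
  apply: le_trans (ler_wpM2l _ SE) _; first by rewrite divr_ge0// ltW.
  by rewrite lerDl.
move=> t t01.
have a0 : 0 <= alpha by apply: le_trans aa; exact: ltW.
have := sparsa_accept_model_bound phiE f_diff f_convex psi_convex f_lip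
  zs acc a0 t01 Kxk Kxk1.
have : alpha * t ^+ 2 * dotp (zs - x k) (zs - x k) <= t ^+ 2 * (beta * D).
  rewrite mulrAC [alpha * _ * _]mulrC; rewrite ler_wpM2l ?sqr_ge0//.
  by rewrite ler_pM ?dotp_ge0// DP.
rewrite /e; lra.
Qed.
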